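(* Let $E$ be a Banach space for which $\mathrm{FBfA}[E]$ is semiprime. Then $\mathrm{FNfA}[E]$ is order dense in $\mathrm{FBfA}[E]$.
   Context: All spaces are real. A vector lattice algebra is a real associative algebra that is also a vector lattice in which the product of positive elements is positive. An $f$-algebra is a vector lattice algebra such that $a\wedge b=0$ and $c\ge 0$ imply $(ac)\wedge b=0=(ca)\wedge b$. A normed (resp. Banach) $f$-algebra is an $f$-algebra equipped with a (complete) submultiplicative lattice norm. It is semiprime if $a^2=0$ implies $a=0$. A lattice-algebra homomorphism is a linear map preserving the lattice operations and the product. Contractive means of operator norm at most $1$. The free normed (resp. Banach) $f$-algebra generated by $E$ is a normed (resp. Banach) $f$-algebra $\mathrm{FNfA}[E]$ (resp. $\mathrm{FBfA}[E]$) together with a linear isometric embedding $\eta_E$ of $E$ into it such that for every normed (resp. Banach) $f$-algebra $A$ and every contractive operator $T\colon E\to A$ there exists a unique lattice-algebra homomorphism $\hat T$ from the free object to $A$ satisfying $\hat T\circ\eta_E=T$ and $\|\hat T\|=\|T\|$. These exist and are unique up to isometric lattice-algebra isomorphism; $\mathrm{FNfA}[E]$ is generated as a vector lattice algebra by $\eta_E(E)$, and $\mathrm{FBfA}[E]$ is the norm completion of $\mathrm{FNfA}[E]$, so that $\mathrm{FNfA}[E]\subseteq\mathrm{FBfA}[E]$. A vector sublattice $Y$ of a vector lattice $X$ is order dense if for every $x\in X$ with $x>0$ (i.e. $x\ge0$, $x\ne0$) there is $y\in Y$ with $0<y\le x$. *)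

(* Defs.v *)
From HB Require Import structures.
From mathcomp Require Import all_boot all_order all_algebra.
From mathcomp Require Import all_classical all_reals all_analysis.

Set Implicit Arguments.
Unset Strict Implicit.
Unset Printing Implicit Defensive.

Import Order.TTheory GRing.Theory Num.Theory.
Import numFieldNormedType.Exports.

Local Open Scope classical_set_scope.
Local Open Scope ring_scope.

Reserved Notation "x ** y" (at level 40, left associativity).
Reserved Notation "x <=v y" (at level 70, no associativity).
Reserved Notation "x <v y" (at level 70, no associativity).

(* The order is a field of its own: a normed module carrying a library order
   would have to be a numDomainType, whose norm is valued in itself. *)
HB.mixin Record isVectorLattice (R : realType) V of GRing.Lmodule R V := {
  vle : V -> V -> Prop ;
  vmeet : V -> V -> V ;
  vjoin : V -> V -> V ;
  vle_refl : forall x : V, vle x x ;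
  vle_anti : forall x y : V, vle x y -> vle y x -> x = y ;
  vle_trans : forall y x z : V, vle x y -> vle y z -> vle x z ;
  vle_meet : forall x y z : V, vle x (vmeet y z) <-> vle x y /\ vle x z ;
  vjoin_le : forall x y z : V, vle (vjoin x y) z <-> vle x z /\ vle y z ;
  vle_add2r : forall z x y : V, vle x y -> vle (x + z) (y + z) ;
  vle_scale : forall (t : R) (x y : V), 0 <= t -> vle x y ->
    vle (t *: x) (t *: y)
}.

#[short(type="vectorLatticeType")]
HB.structure Definition VectorLattice (R : realType) :=
  {V of GRing.Lmodule R V & isVectorLattice R V}.

Notation "x <=v y" := (vle x y) : ring_scope.
Notation "x <v y" := (vle x y /\ x <> y) : ring_scope.

(* Algebras are not assumed to be unital or commutative, which rules out
   the structures of ssralg. *)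
HB.mixin Record VectorLattice_isAlgebra (R : realType) A
    of VectorLattice R A := {
  vmul : A -> A -> A ;
  vmulA : forall a b c : A, vmul a (vmul b c) = vmul (vmul a b) c ;
  vmulDl : forall a b c : A, vmul (a + b) c = vmul a c + vmul b c ;
  vmulDr : forall a b c : A, vmul a (b + c) = vmul a b + vmul a c ;
  vmulZl : forall (t : R) (a b : A), vmul (t *: a) b = t *: vmul a b ;
  vmulZr : forall (t : R) (a b : A), vmul a (t *: b) = t *: vmul a b ;
  vmul_ge0 : forall a b : A, 0 <=v a -> 0 <=v b -> 0 <=v vmul a b
}.

#[short(type="vlAlgType")]
HB.structure Definition VLAlgebra (R : realType) :=
  {A of VectorLattice R A & VectorLattice_isAlgebra R A}.

Notation "x ** y" := (vmul x y) : ring_scope.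

HB.mixin Record VLAlgebra_isFAlgebra (R : realType) A of VLAlgebra R A := {
  falg_disjoint : forall a b c : A, vmeet a b = 0 -> 0 <=v c ->
    vmeet (a ** c) b = 0 /\ vmeet (c ** a) b = 0
}.

#[short(type="fAlgType")]
HB.structure Definition FAlgebra (R : realType) :=
  {A of VLAlgebra R A & VLAlgebra_isFAlgebra R A}.

Definition vabs (R : realType) (V : vectorLatticeType R) (x : V) : V :=
  vjoin x (- x).

HB.mixin Record isNormedFAlgebra (R : realType) A
    of FAlgebra R A & NormedModule R A := {
  lattice_norm : forall x y : A, vabs x <=v vabs y -> `|x| <= `|y| ;
  submul_norm : forall x y : A, `|x ** y| <= `|x| * `|y|
}.

#[short(type="normedFAlgType")]
HB.structure Definition NormedFAlgebra (R : realType) :=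
  {A of FAlgebra R A & NormedModule R A & isNormedFAlgebra R A}.

#[short(type="banachFAlgType")]
HB.structure Definition BanachFAlgebra (R : realType) :=
  {A of NormedFAlgebra R A & Complete A}.

Definition semiprime (R : realType) (A : vlAlgType R) : Prop :=
  forall a : A, a ** a = 0 -> a = 0.

Definition lattice_algebra_hom (R : realType) (A B : vlAlgType R)
    (h : {linear A -> B}) : Prop :=
  [/\ forall x y, h (vmeet x y) = vmeet (h x) (h y),
      forall x y, h (vjoin x y) = vjoin (h x) (h y)
    & forall x y, h (x ** y) = h x ** h y].

(* Extended-real valued: +oo when [T] is unbounded. *)
Definition opnorm (R : realType) (V W : normedModType R)
    (T : {linear V -> W}) : \bar R :=
  ereal_sup [set (`|T x|)%:E | x in [set x : V | `|x| <= 1]].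

Definition contractive (R : realType) (V W : normedModType R)
    (T : {linear V -> W}) : Prop :=
  (opnorm T <= 1%:E)%E.

(* [eta : E -> F] solves the universal problem for maps from [E] into [A].
   Uniqueness is among all the lattice-algebra homomorphisms extending [T];
   were it only among those of norm [opnorm T], then for [E = 0] every [F]
   would qualify. *)
Definition universal_into (R : realType) (E : normedModType R)
    (F : normedFAlgType R) (eta : {linear E -> F}) (A : normedFAlgType R)
    : Prop :=
  forall T : {linear E -> A}, contractive T ->
  exists That : {linear F -> A},
    [/\ lattice_algebra_hom That,
        forall x : E, That (eta x) = T x,
        opnorm That = opnorm T
      & forall S : {linear F -> A}, lattice_algebra_hom S ->
          (forall x : E, S (eta x) = T x) -> forall z : F, S z = That z].

Definition is_FNfA (R : realType) (E : normedModType R)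
    (F : normedFAlgType R) (eta : {linear E -> F}) : Prop :=
  (forall x : E, `|eta x| = `|x|) /\
  (forall A : normedFAlgType R, universal_into eta A).

Definition is_FBfA (R : realType) (E : normedModType R)
    (F : banachFAlgType R) (eta : {linear E -> F}) : Prop :=
  (forall x : E, `|eta x| = `|x|) /\
  (forall A : banachFAlgType R, universal_into eta A).

Definition vector_sublattice (R : realType) (X : vectorLatticeType R)
    (Y : set X) : Prop :=
  [/\ Y 0,
      forall x y, Y x -> Y y -> Y (x + y),
      forall (t : R) x, Y x -> Y (t *: x),
      forall x y, Y x -> Y y -> Y (vmeet x y)
    & forall x y, Y x -> Y y -> Y (vjoin x y)].

Definition order_dense (R : realType) (X : vectorLatticeType R)
    (Y : set X) : Prop :=
  vector_sublattice Y /\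
  forall x : X, 0 <v x -> exists2 y : X, Y y & 0 <v y /\ y <=v x.

(* Main.v *)
Require Import Defs.
From HB Require Import structures.
From mathcomp Require Import all_boot all_order all_algebra.
From mathcomp Require Import all_classical all_reals all_analysis.
From mathcomp Require Import lra.

Set Implicit Arguments.
Unset Strict Implicit.
Unset Printing Implicit Defensive.

Import Order.TTheory GRing.Theory Num.Theory.
Import numFieldNormedType.Exports.

Local Open Scope classical_set_scope.
Local Open Scope ring_scope.

(** Let [B] be the Banach f-algebra generated by [E] and [Y] the image of the
    normed one. Two facts suffice.

    First, [Y] is norm dense ([FBfA_dense]). The closure [C] of [Y] is a closed
    lattice subalgebra, so it is a Banach f-algebra containing [eta E]. The
    universal property extends [eta : E -> C] to a homomorphism [B -> C]; viewed
    as a map into [B], it and the identity extend the same [eta], so they are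
    equal and [C] is all of [B].

    Second, in any semiprime normed f-algebra a norm dense lattice subalgebra
    is order dense ([dense_fsubalgebra_order_dense]). Norm density alone does
    not give this for Banach lattices: an approximation [y] of [x > 0] need not
    lie below [x]. In a normed f-algebra, however, multiplication by [a] is
    dominated by the scalar [`|a|]: [a ** b <= r b] and [b ** a <= r b] as soon
    as [`|a| < r] and [0 <= b] ([vmul_le_norm]). Hence a norm estimate
    [`|y - x| < e] turns into the order estimate [y ** y - e y <= x ** y], and
    [x ** y] lies below a multiple of [x]. So a multiple of the positive part
    of [y ** y - e y], which belongs to [Y], lies below [x]; this positive part
    tends to [x ** x] as [y] tends to [x] and [e] tends to [0], and
    [x ** x <> 0] because the algebra is semiprime.

    The domination by scalars follows from [contraction_le], applied to
    multiplication by a positive element of norm less than [1]. *)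

(** * Vector lattices *)

Arguments vle_trans {R s y x z}.
Arguments vle_add2r {R s} z {x y}.
Arguments vle_anti {R s x y}.
Arguments vle_scale {R s} t {x y}.

Section VectorLatticeTheory.
Context {R : realType} {V : vectorLatticeType R}.
Implicit Types (x y z u v w : V).

Definition vpos x : V := vjoin x 0.

Lemma vmeet_lel x y : vmeet x y <=v x.
Proof. by have /vle_meet[] := vle_refl (vmeet x y). Qed.

Lemma vmeet_ler x y : vmeet x y <=v y.
Proof. by have /vle_meet[] := vle_refl (vmeet x y). Qed.

Lemma vle_joinl x y : x <=v vjoin x y.
Proof. by have /vjoin_le[] := vle_refl (vjoin x y). Qed.

Lemma vle_joinr x y : y <=v vjoin x y.
Proof. by have /vjoin_le[] := vle_refl (vjoin x y). Qed.

Lemma vmeetC x y : vmeet x y = vmeet y x.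
Proof.
by apply: vle_anti; apply/vle_meet; split;
  by [exact: vmeet_lel | exact: vmeet_ler].
Qed.

Lemma vsubr_ge0 x y : 0 <=v y - x <-> x <=v y.
Proof.
split=> [/(vle_add2r x)|/(vle_add2r (- x))]; first by rewrite subrK add0r.
by rewrite subrr.
Qed.

Lemma vle_subl x y z : x - y <=v z <-> x <=v z + y.
Proof.
split=> [/(vle_add2r y)|/(vle_add2r (- y))]; first by rewrite subrK.
by rewrite addrK.
Qed.

Lemma vle_addr x y : 0 <=v y -> x <=v x + y.
Proof. by move=> y0; apply/vsubr_ge0; rewrite [x + y]addrC addrK. Qed.

Lemma vle_add x y z w : x <=v y -> z <=v w -> x + z <=v y + w.
Proof.
move=> xy zw; apply: (vle_trans (vle_add2r z xy)).
by rewrite ![y + _]addrC; exact: vle_add2r.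
Qed.

Lemma vle_opp x y : x <=v y -> - y <=v - x.
Proof.
by move/(vle_add2r (- x - y)); rewrite addrA subrr add0r addrCA subrr addr0.
Qed.

Lemma vaddr_ge0 x y : 0 <=v x -> 0 <=v y -> 0 <=v x + y.
Proof. by move=> x0 y0; rewrite -[0]addr0; exact: vle_add. Qed.

Lemma vscale_le_inv (t : R) x y : 0 < t -> t *: x <=v t *: y -> x <=v y.
Proof.
move=> t0 /(vle_scale t^-1); rewrite !scalerA mulVf ?gt_eqF// !scale1r.
by apply; rewrite invr_ge0 ltW.
Qed.

Lemma vpos_ge0 x : 0 <=v vpos x. Proof. exact: vle_joinr. Qed.

Lemma vle_pos x : x <=v vpos x. Proof. exact: vle_joinl. Qed.

Lemma vpos_le x y : 0 <=v y -> x <=v y -> vpos x <=v y.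
Proof. by move=> y0 xy; apply/vjoin_le. Qed.

Lemma vpos_id x : 0 <=v x -> vpos x = x.
Proof.
move=> x0; apply: vle_anti; last exact: vle_pos.
by apply: vpos_le => //; exact: vle_refl.
Qed.

Lemma vpos_decomp x : x = vpos x - vpos (- x).
Proof.
apply: (@addIr _ (vpos (- x))); rewrite subrK; apply: vle_anti; last first.
  apply: vpos_le; last exact/vle_addr/vpos_ge0.
  by have /(vle_add2r x) := vle_pos (- x); rewrite addNr addrC.
rewrite addrC -[X in _ + X]opprK; apply/vle_subl; apply: vpos_le.
  by apply/vsubr_ge0/vle_pos.
by rewrite -[X in X <=v _]add0r; exact/vle_add2r/vpos_ge0.
Qed.

Lemma vpos_disjoint x : vmeet (vpos x) (vpos (- x)) = 0.
Proof.
apply: vle_anti; last by apply/vle_meet; split; exact: vpos_ge0.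
set m := vmeet _ _.
have : vpos x <=v vpos x - m.
  apply: vpos_le; first exact/vsubr_ge0/vmeet_lel.
  rewrite {1}[x]vpos_decomp [vpos x - m]addrC [vpos x - _]addrC.
  exact/vle_add2r/vle_opp/vmeet_ler.
by move/(vle_add2r (m - vpos x)); rewrite addrCA subrr addr0 addrA subrK subrr.
Qed.

(** The difference [u - t] lies below both [w] and [u], hence below [0]. *)
Lemma disjoint_le_add u t w :
  0 <=v t -> vmeet w u = 0 -> u <=v t + w -> u <=v t.
Proof.
move=> t0 wu utw; rewrite -[t]add0r; apply/vle_subl; rewrite -wu.
apply/vle_meet; split; first by apply/vle_subl; rewrite addrC.
exact/vle_subl/vle_addr.
Qed.

Lemma disjoint_add u v w : 0 <=v u -> 0 <=v v -> 0 <=v w ->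
  vmeet v u = 0 -> vmeet w u = 0 -> vmeet (v + w) u = 0.
Proof.
move=> u0 v0 w0 vu wu; apply: vle_anti; last first.
  by apply/vle_meet; split=> //; exact: vaddr_ge0.
rewrite -vu; apply/vle_meet; split; last exact: vmeet_ler.
apply: (@disjoint_le_add _ _ w) => //; last exact: vmeet_lel.
apply: vle_anti; last first.
  by do !(apply/vle_meet; split=> //); exact: vaddr_ge0.
rewrite -wu; apply/vle_meet; split; first exact: vmeet_lel.
exact: vle_trans (vmeet_ler _ _) (vmeet_ler _ _).
Qed.

Lemma vle_abs x : x <=v vabs x. Proof. exact: vle_joinl. Qed.

Lemma vle_absN x : - x <=v vabs x. Proof. exact: vle_joinr. Qed.

Lemma vabs_ge0 x : 0 <=v vabs x.
Proof.
apply: (@vscale_le_inv 2) => //; rewrite scaler0 -(subrr x) scaler_nat mulr2n.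
apply: vle_add; [exact: vle_abs|exact: vle_absN].
Qed.

Lemma vabs_le x y : x <=v y -> - x <=v y -> vabs x <=v y.
Proof. by move=> xy Nxy; apply/vjoin_le. Qed.

Lemma vabs_id x : 0 <=v x -> vabs x = x.
Proof.
move=> x0; apply: vle_anti (vle_abs x); apply: vabs_le; first exact: vle_refl.
by apply: (vle_trans _ x0); rewrite -oppr0; exact: vle_opp.
Qed.

Lemma vpos_sub_le x y : vpos x - vpos y <=v vabs (x - y).
Proof.
apply/vle_subl; apply: vpos_le.
  by apply: vaddr_ge0; [exact: vabs_ge0|exact: vpos_ge0].
by rewrite -{1}[x](subrK y); apply: vle_add; [exact: vle_abs|exact: vle_pos].
Qed.

Lemma vabs_pos_sub x y : vabs (vpos x - vpos y) <=v vabs (x - y).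
Proof.
apply: vabs_le; first exact: vpos_sub_le.
rewrite opprB; apply: vle_trans (vpos_sub_le _ _) _.
rewrite /vabs !opprB.
by apply/vjoin_le; split; [exact: vle_joinr|exact: vle_joinl].
Qed.

Lemma vjoinE x y : vjoin x y = vpos (x - y) + y.
Proof.
apply: vle_anti.
  apply/vjoin_le; split; first exact/vle_subl/vle_pos.
  by rewrite addrC; exact/vle_addr/vpos_ge0.
rewrite -[X in _ + X]opprK; apply/vle_subl; apply: vpos_le.
  exact/vsubr_ge0/vle_joinr.
exact/vle_add2r/vle_joinl.
Qed.

Lemma vmeetE x y : vmeet x y = x - vpos (x - y).
Proof.
apply: vle_anti.
  rewrite -[X in _ <=v X]opprK -[X in X <=v _]opprK; apply: vle_opp.
  rewrite opprB; apply/vle_subl; apply: vpos_le.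
    by rewrite addrC; exact/vsubr_ge0/vmeet_lel.
  by rewrite [x - y]addrC; exact/vle_add2r/vle_opp/vmeet_ler.
apply/vle_meet; split; first exact/vle_subl/vle_addr/vpos_ge0.
by apply/vle_subl; rewrite addrC; apply/vle_subl/vle_pos.
Qed.

End VectorLatticeTheory.

(** * Normed f-algebras and order density *)

Section NormedFAlgebraTheory.
Context {R : realType} {A : normedFAlgType R}.
Implicit Types (a b c x y z : A) (r : R).

Lemma le_vnorm x y : 0 <=v x -> x <=v y -> `|x| <= `|y|.
Proof.
move=> x0 xy; apply: lattice_norm; rewrite vabs_id// vabs_id//.
exact: vle_trans x0 xy.
Qed.

Lemma vnorm_abs x : `|vabs x| = `|x|.
Proof.
by apply/le_anti/andP; split; apply: lattice_norm;
  rewrite (vabs_id (vabs_ge0 x)); exact: vle_refl.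
Qed.

Lemma vnorm_pos_sub x y : `|vpos x - vpos y| <= `|x - y|.
Proof. exact/lattice_norm/vabs_pos_sub. Qed.

Lemma vmulNr a b : (- a) ** b = - (a ** b).
Proof. by rewrite -scaleN1r vmulZl scaleN1r. Qed.

Lemma vmulrN a b : a ** (- b) = - (a ** b).
Proof. by rewrite -scaleN1r vmulZr scaleN1r. Qed.

(** Such a [T] preserves bands. On the band where [T b >= b], iterating gives
    [b <= T b <= T (T b) <= ...], although these iterates tend to [0] in norm;
    so [b] vanishes there. Band projections need not exist: instead of being
    restricted to that band, the inequalities hold up to an error term [w] that
    is disjoint from [u], the positive part of [T b - b]. *)
Lemma contraction_le (T : A -> A) r :
  (forall x y, T (x + y) = T x + T y) -> (forall x, 0 <=v x -> 0 <=v T x) ->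
  (forall x y, 0 <=v x -> vmeet x y = 0 -> vmeet (T x) y = 0) ->
  0 <= r < 1 -> (forall x, `|T x| <= r * `|x|) ->
  forall b, 0 <=v b -> T b <=v b.
Proof.
move=> TD T0 Tdisj /andP[r0 r1] Tr b b0.
set u := vpos (T b - b); set v := vpos (- (T b - b)).
have u0 : 0 <=v u by exact: vpos_ge0.
have v0 : 0 <=v v by exact: vpos_ge0.
have vu : vmeet v u = 0 by rewrite vmeetC; exact: vpos_disjoint.
have Tmono x y : x <=v y -> T x <=v T y.
  move=> /vsubr_ge0/T0 Txy; rewrite -(subrK x y) TD [T _ + _]addrC.
  exact: vle_addr.
have b_le n : exists w, [/\ 0 <=v w, vmeet w u = 0 & b <=v iter n T b + w].
  elim: n => [|n [w [w0 wu bw]]].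
    exists 0; split; [exact: vle_refl| |by rewrite addr0; exact: vle_refl].
    apply: vle_anti; first exact: vmeet_lel.
    by apply/vle_meet; split=> //; exact: vle_refl.
  exists (T w + v); split; first by apply: vaddr_ge0 => //; exact: T0.
    by apply: disjoint_add => //; [exact: T0|exact: Tdisj].
  have bTv : b <=v T b + v.
    by rewrite addrC; apply/vle_subl; rewrite -opprB; exact: vle_pos.
  apply: vle_trans bTv _; rewrite addrA iterS -TD; apply: vle_add2r.
  exact: Tmono.
have iter0 n : 0 <=v iter n T b by elim: n => //= n; exact: T0.
(* From [u <= T b <= iter n.+1 T b + T w] the term [T w] can be dropped, because
   it is disjoint from [u]. *)
have u_le n : u <=v iter n.+1 T b.
  have [w [w0 wu bw]] := b_le n.
  apply: (@disjoint_le_add _ _ _ _ (T w)) => //; first exact: Tdisj.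
  rewrite iterS -TD; apply: (vle_trans _ (Tmono _ _ bw)).
  apply: vpos_le; first exact: T0.
  exact/vle_subl/vle_addr.
have iter_norm n : `|iter n T b| <= r ^+ n * `|b|.
  elim: n => [|n IH]; first by rewrite mul1r.
  by rewrite iterS (le_trans (Tr _))// exprS -mulrA ler_wpM2l.
have un0 : `|u| <= 0.
  have rn0 : geometric `|b| r @ \oo --> 0.
    by apply: cvg_geometric; rewrite ger0_norm.
  apply: (cvgr_to_ge rn0); exists 1 => // -[//|n] _ /=; rewrite mulrC.
  exact: le_trans (le_vnorm u0 (u_le n)) (iter_norm _).
have /eqP : `|u| = 0 by apply/le_anti; rewrite un0 normr_ge0.
rewrite normr_eq0 => /eqP u_eq0; rewrite -[X in _ <=v X]add0r.
by apply/vle_subl; rewrite -u_eq0; exact: vle_pos.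
Qed.

(** Multiplication by the positive element [c], the absolute value of [a]
    divided by [r], shrinks norms by the factor [`|c| < 1], and it preserves
    disjointness by the f-algebra axiom: [contraction_le] applies to it, on
    either side. *)
Lemma vmul_le_norm a b r : `|a| < r -> 0 <=v b ->
  a ** b <=v r *: b /\ b ** a <=v r *: b.
Proof.
move=> ar b0; have r0 : 0 < r by exact: le_lt_trans ar.
set c := r^-1 *: vabs a.
have c0 : 0 <=v c.
  rewrite -(scaler0 _ r^-1); apply: vle_scale; first by rewrite invr_ge0 ltW.
  exact: vabs_ge0.
have nc : 0 <= `|c| < 1.
  rewrite normr_ge0 normrZ vnorm_abs gtr0_norm ?invr_gt0//.
  by rewrite ltr_pdivrMl// mulr1.
have ca : r *: c = vabs a by rewrite scalerA divff ?gt_eqF// scale1r.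
have cb : c ** b <=v b.
  apply: (@contraction_le (fun x => c ** x)) nc _ _ b0.
  - by move=> x y; exact: vmulDr.
  - by move=> x x0; exact: vmul_ge0.
  - by move=> x y _ xy; have [] := falg_disjoint _ _ _ xy c0.
  - by move=> x; exact: submul_norm.
have bc : b ** c <=v b.
  apply: (@contraction_le (fun x => x ** c)) nc _ _ b0.
  - by move=> x y; exact: vmulDl.
  - by move=> x x0; exact: vmul_ge0.
  - by move=> x y _ xy; have [] := falg_disjoint _ _ _ xy c0.
  - by move=> x; rewrite mulrC; exact: submul_norm.
have a_le : 0 <=v vabs a - a by apply/vsubr_ge0/vle_abs.
split.
- apply: (@vle_trans _ _ (vabs a ** b)).
    by apply/vsubr_ge0; rewrite -vmulNr -vmulDl; exact: vmul_ge0.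
  by rewrite -ca vmulZl; apply: vle_scale => //; exact: ltW.
- apply: (@vle_trans _ _ (b ** vabs a)).
    by apply/vsubr_ge0; rewrite -vmulrN -vmulDr; exact: vmul_ge0.
  by rewrite -ca vmulZr; apply: vle_scale => //; exact: ltW.
Qed.

Lemma closure_approx (Y : set A) x e : closure Y x -> 0 < e ->
  exists2 y, Y y & `|x - y| < e.
Proof.
move=> Yx e0; have [y [Yy xy]] := Yx _ (nbhsx_ballx x e e0).
by exists y; rewrite // -ball_normE in xy.
Qed.

Definition fsubalgebra (Y : set A) : Prop :=
  vector_sublattice Y /\ forall x y, Y x -> Y y -> Y (x ** y).

Lemma fsubalgebra_pos (Y : set A) x : fsubalgebra Y -> Y x -> Y (vpos x).
Proof. by move=> [[Y0 _ _ _ Yjoin] _] Yx; exact: Yjoin. Qed.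

Lemma fsubalgebra_opp (Y : set A) x : fsubalgebra Y -> Y x -> Y (- x).
Proof. by move=> [[_ _ YZ _ _] _] Yx; rewrite -scaleN1r; exact: YZ. Qed.

(** The element of [Y] below [x] is a multiple of the positive part [w] of
    [y ** y - e *: y], for a positive [y] in [Y] within [e] of [x]. Comparing
    [x] with the multiplication operators is what makes [w] lie below a
    multiple of [x]; semiprimeness is what makes [w] nonzero. *)
Lemma dense_fsubalgebra_order_dense (Y : set A) : semiprime A ->
  fsubalgebra Y -> (forall x, closure Y x) -> order_dense Y.
Proof.
move=> A_semiprime YA Yd; have [Ylat Ymul] := YA; split=> // x [x0 /nesym xN0].
have [_ YD YZ _ _] := Ylat.
have xx0 : 0 < `|x ** x|.
  by rewrite normr_gt0; apply/eqP => /A_semiprime.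
(* If [y ** y <= e *: y], then [`|x ** x| < e * (`|x| + 2 * `|y|)], which is at
   most [e * d] because [`|y| <= `|x| + 1]. *)
pose d := 3 * `|x| + 2.
have d0 : 0 < d by rewrite ltr_wpDl// mulr_ge0.
pose e := Num.min 1 (`|x ** x| / d).
have e0 : 0 < e by rewrite lt_min ltr01 divr_gt0.
have e1 : e <= 1 by rewrite ge_min lexx.
have ed : e * d <= `|x ** x| by rewrite -ler_pdivlMr// ge_min lexx orbT.
have [y' Yy' xy'] := closure_approx (Yd x) e0.
pose y := vpos y'.
have Yy : Y y by exact: fsubalgebra_pos.
have y0 : 0 <=v y by exact: vpos_ge0.
have xy : `|x - y| < e.
  by rewrite -{1}(vpos_id x0); exact: le_lt_trans (vnorm_pos_sub _ _) xy'.
have ny : `|y| < `|x| + e.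
  by rewrite -[y](subrK x) addrC (le_lt_trans (ler_normD _ _))// ltrD2l distrC.
pose w := vpos (y ** y - e *: y).
have wxy : w <=v x ** y.
  apply: vpos_le; first exact: vmul_ge0.
  apply/vle_subl; rewrite addrC; apply/vle_subl; rewrite -vmulNr -vmulDl.
  by apply: (proj1 (vmul_le_norm _ y0)); rewrite distrC.
pose r := `|x| + e.
have r0 : 0 < r by rewrite ltr_wpDl.
exists (r^-1 *: w).
  apply: (YZ); apply: fsubalgebra_pos => //; apply: YD; first exact: Ymul.
  by apply: fsubalgebra_opp => //; exact: YZ.
have ri0 : 0 <= r^-1 by rewrite invr_ge0 ltW.
split; [split|].
- by rewrite -(scaler0 _ r^-1); apply: vle_scale => //; exact: vpos_ge0.
- move/esym/eqP; rewrite scaler_eq0 invr_eq0 gt_eqF//= => /eqP w0.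
  have yy : `|y ** y| <= e * `|y|.
    rewrite -[e in leRHS]gtr0_norm// -normrZ.
    apply: le_vnorm; first exact: vmul_ge0.
    rewrite -[X in _ <=v X]add0r; apply/vle_subl; rewrite -[X in _ <=v X]w0.
    exact: vle_pos.
  have : `|x ** x| < e * d.
    have -> : x ** x = x ** (x - y) + ((x - y) ** y + y ** y).
      by rewrite vmulDr vmulDl vmulrN vmulNr subrK subrK.
    have h1 := submul_norm x (x - y); have h2 := submul_norm (x - y) y.
    have := ler_normD (x ** (x - y)) ((x - y) ** y + y ** y).
    have := ler_normD ((x - y) ** y) (y ** y).
    have := normr_ge0 x; have := normr_ge0 y; have := normr_ge0 (x - y).
    rewrite /d; nra.
  by rewrite ltNge ed.
- apply: (@vscale_le_inv _ _ r) => //.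
  rewrite scalerA divff ?gt_eqF// scale1r; apply: vle_trans wxy _.
  exact: (proj2 (vmul_le_norm ny x0)).
Qed.

(** * Closed lattice subalgebras *)

Lemma vpos_continuous : continuous (@vpos R A).
Proof.
move=> x; apply/cvgrPdist_lt => e e0; near=> y.
apply: (le_lt_trans (vnorm_pos_sub _ _)).
by near: y; exact: cvgr_dist_lt.
Unshelve. all: by end_near. Qed.

Lemma vmul_continuous : continuous (fun p : A * A => p.1 ** p.2).
Proof.
move=> [a b]; apply/cvgrPdist_le => e e0.
(* The difference of the products is at most [d * `|a| + d * `|y|] within
   distance [d] of [(a, b)], where [`|y| <= `|b| + 1]. *)
pose k := `|a| + `|b| + 1.
have k0 : 0 < k by rewrite ltr_wpDl// addr_ge0.
pose d := Num.min 1 (e / k).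
have d0 : 0 < d by rewrite lt_min ltr01 divr_gt0.
have d1 : d <= 1 by rewrite ge_min lexx.
have dk : d * k <= e by rewrite -ler_pdivlMr// ge_min lexx orbT.
near=> p.
have ax : `|a - p.1| < d by near: p; apply: cvgr_dist_lt => //; exact: cvg_fst.
have bY : `|b - p.2| < d by near: p; apply: cvgr_dist_lt => //; exact: cvg_snd.
move: ax bY; set x := p.1; set y := p.2 => ax bY.
rewrite (_ : _ - _ = a ** (b - y) + (a - x) ** y); last first.
  by rewrite vmulDr vmulDl vmulrN vmulNr addrA subrK.
have := ler_normD (a ** (b - y)) ((a - x) ** y).
have := submul_norm a (b - y); have := submul_norm (a - x) y.
have : `|y| <= `|b| + `|b - y|.
  by rewrite -{1}[y](subrK b) addrC distrC; exact: ler_normD.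
have := normr_ge0 a; have := normr_ge0 y; have := normr_ge0 (a - x).
move: dk; rewrite /k; nra.
Unshelve. all: by end_near. Qed.

Lemma closure_stable2 (Y : set A) (f : A * A -> A) : continuous f ->
  (forall x y, Y x -> Y y -> Y (f (x, y))) ->
  forall x y, closure Y x -> closure Y y -> closure Y (f (x, y)).
Proof.
move=> fc Yf x y Yx Yy U /fc [[/= V W] [Vx Wy] VWU].
have [v [Yv Vv]] := Yx _ Vx; have [w [Yw Ww]] := Yy _ Wy.
by exists (f (v, w)); split; [exact: Yf|exact: VWU].
Qed.

(** Both lattice operations are affine in [vpos (x - y)], so their continuity
    reduces to that of the positive part, which is 1-Lipschitz. *)
Lemma closure_fsubalgebra (Y : set A) :
  fsubalgebra Y -> fsubalgebra (closure Y).
Proof.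
move=> [[Y0 YD YZ Ymeet Yjoin] YM].
pose dpos (p : A * A) := vpos (p.1 - p.2).
have dposc : continuous dpos.
  move=> p; apply: (@continuous_comp _ _ _ (fun p : A * A => p.1 - p.2)).
    by apply: continuousB; [exact: cvg_fst|exact: cvg_snd].
  exact: vpos_continuous.
split; last exact: closure_stable2 vmul_continuous YM.
split.
- exact: subset_closure.
- apply: (@closure_stable2 _ (fun p => p.1 + p.2)) => //.
  exact: add_continuous.
- move=> t x Yx; apply: (@closure_stable2 _ (fun p => t *: p.1) _ _ x x) => //.
    by move=> p; apply: cvgZr; exact: cvg_fst.
  by move=> u v Yu _; exact: YZ.
- apply: (@closure_stable2 _ (fun p => vmeet p.1 p.2)) => //.
  rewrite (_ : (fun p => _) = fun p => p.1 - dpos p).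
    by move=> p; apply: cvgB; [exact: cvg_fst|exact: dposc].
  by apply/funext => p; exact: vmeetE.
- apply: (@closure_stable2 _ (fun p => vjoin p.1 p.2)) => //.
  rewrite (_ : (fun p => _) = fun p => dpos p + p.2).
    by move=> p; apply: cvgD; [exact: dposc|exact: cvg_snd].
  by apply/funext => p; exact: vjoinE.
Qed.

End NormedFAlgebraTheory.

Section ClosedSubalgebra.
Context {R : realType} {A : banachFAlgType R}.

(** Bundling the closure properties lets the carrier type [cs_type] receive its
    structures by inference, as the universal property quantifies over
    structures and not over subsets. *)
Record closedSubalgebra := ClosedSubalgebra {
  cs_set : set A;
  cs_fsubalgebra : fsubalgebra cs_set;
  cs_closed : closed cs_set
}.

Variable C : closedSubalgebra.

Definition cs_type : Type := {x : A | x \in cs_set C}.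

HB.instance Definition _ := [isSub of cs_type for @sval _ _].
HB.instance Definition _ := [Choice of cs_type by <:].

Lemma cs_subsemimod : subsemimod_closed (mem (cs_set C)).
Proof.
have [[C0 CD CZ _ _] _] := cs_fsubalgebra C.
split; first split; rewrite ?inE//.
  by move=> x y; rewrite !inE; exact: CD.
by move=> t x; rewrite !inE; exact: CZ.
Qed.

HB.instance Definition _ :=
  GRing.SubChoice_isSubLmodule.Build R A (mem (cs_set C)) cs_type cs_subsemimod.

Implicit Types x y z : cs_type.

Lemma cs_valP x : cs_set C (val x). Proof. by have := valP x; rewrite inE. Qed.

Definition cs_mk (a : A) (Ca : cs_set C a) : cs_type := Sub a (mem_set Ca).

Lemma cs_mkK a (Ca : cs_set C a) : val (cs_mk Ca) = a. Proof. exact: SubK. Qed.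

Lemma cs_valD x y : val (x + y) = val x + val y. Proof. exact: raddfD. Qed.

Lemma cs_valB x y : val (x - y) = val x - val y. Proof. exact: raddfB. Qed.

Lemma cs_valZ (t : R) x : val (t *: x) = t *: val x. Proof. exact: linearZ. Qed.

Lemma cs_val0 : val (0 : cs_type) = 0. Proof. exact: raddf0. Qed.

Let C_meet a b : cs_set C a -> cs_set C b -> cs_set C (vmeet a b).
Proof. by have [[_ _ _ Cm _] _] := cs_fsubalgebra C; exact: Cm. Qed.

Let C_join a b : cs_set C a -> cs_set C b -> cs_set C (vjoin a b).
Proof. by have [[_ _ _ _ Cj] _] := cs_fsubalgebra C; exact: Cj. Qed.

Let C_mul a b : cs_set C a -> cs_set C b -> cs_set C (a ** b).
Proof. by have [_ Cm] := cs_fsubalgebra C; exact: Cm. Qed.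

Definition cs_le x y : Prop := val x <=v val y.
Definition cs_meet x y := cs_mk (C_meet (cs_valP x) (cs_valP y)).
Definition cs_join x y := cs_mk (C_join (cs_valP x) (cs_valP y)).
Definition cs_mul x y := cs_mk (C_mul (cs_valP x) (cs_valP y)).

Lemma cs_le_refl x : cs_le x x. Proof. exact: vle_refl. Qed.

Lemma cs_le_anti x y : cs_le x y -> cs_le y x -> x = y.
Proof. by move=> xy yx; apply: val_inj; exact: vle_anti. Qed.

Lemma cs_le_trans y x z : cs_le x y -> cs_le y z -> cs_le x z.
Proof. exact: vle_trans. Qed.

Lemma cs_le_meet x y z : cs_le x (cs_meet y z) <-> cs_le x y /\ cs_le x z.
Proof. by rewrite /cs_le cs_mkK; exact: vle_meet. Qed.

Lemma cs_join_le x y z : cs_le (cs_join x y) z <-> cs_le x z /\ cs_le y z.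
Proof. by rewrite /cs_le cs_mkK; exact: vjoin_le. Qed.

Lemma cs_le_add2r z x y : cs_le x y -> cs_le (x + z) (y + z).
Proof. by rewrite /cs_le !cs_valD; exact: vle_add2r. Qed.

Lemma cs_le_scale (t : R) x y : 0 <= t -> cs_le x y -> cs_le (t *: x) (t *: y).
Proof. by rewrite /cs_le !cs_valZ; exact: vle_scale. Qed.

HB.instance Definition _ := isVectorLattice.Build R cs_type
  cs_le_refl cs_le_anti cs_le_trans cs_le_meet cs_join_le
  cs_le_add2r cs_le_scale.

Lemma cs_mulA x y z : cs_mul x (cs_mul y z) = cs_mul (cs_mul x y) z.
Proof. by apply: val_inj; rewrite !cs_mkK vmulA. Qed.

Lemma cs_mulDl x y z : cs_mul (x + y) z = cs_mul x z + cs_mul y z.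
Proof. by apply: val_inj; rewrite cs_valD !cs_mkK cs_valD vmulDl. Qed.

Lemma cs_mulDr x y z : cs_mul x (y + z) = cs_mul x y + cs_mul x z.
Proof. by apply: val_inj; rewrite cs_valD !cs_mkK cs_valD vmulDr. Qed.

Lemma cs_mulZl (t : R) x y : cs_mul (t *: x) y = t *: cs_mul x y.
Proof. by apply: val_inj; rewrite cs_valZ !cs_mkK cs_valZ vmulZl. Qed.

Lemma cs_mulZr (t : R) x y : cs_mul x (t *: y) = t *: cs_mul x y.
Proof. by apply: val_inj; rewrite cs_valZ !cs_mkK cs_valZ vmulZr. Qed.

Lemma cs_mul_ge0 x y : 0 <=v x -> 0 <=v y -> 0 <=v cs_mul x y.
Proof. by rewrite /vle /= /cs_le cs_val0 cs_mkK; exact: vmul_ge0. Qed.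

HB.instance Definition _ := VectorLattice_isAlgebra.Build R cs_type
  cs_mulA cs_mulDl cs_mulDr cs_mulZl cs_mulZr cs_mul_ge0.

Lemma cs_val_meet x y : val (vmeet x y) = vmeet (val x) (val y).
Proof. exact: cs_mkK. Qed.

Lemma cs_val_join x y : val (vjoin x y) = vjoin (val x) (val y).
Proof. exact: cs_mkK. Qed.

Lemma cs_val_mul x y : val (x ** y) = val x ** val y.
Proof. exact: cs_mkK. Qed.

Lemma cs_disjoint x y z : vmeet x y = 0 -> 0 <=v z ->
  vmeet (x ** z) y = 0 /\ vmeet (z ** x) y = 0.
Proof.
move=> /(congr1 val); rewrite cs_val_meet cs_val0 => xy.
rewrite {1}/vle /= /cs_le cs_val0 => z0.
have [xz zx] := falg_disjoint _ _ _ xy z0.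
by split; apply: val_inj; rewrite cs_val_meet cs_val_mul cs_val0.
Qed.

HB.instance Definition _ := VLAlgebra_isFAlgebra.Build R cs_type cs_disjoint.

Definition cs_norm x : R := `|val x|.

Lemma cs_ler_normD x y : cs_norm (x + y) <= cs_norm x + cs_norm y.
Proof. by rewrite /cs_norm cs_valD ler_normD. Qed.

Lemma cs_normrZ (t : R) x : cs_norm (t *: x) = `|t| * cs_norm x.
Proof. by rewrite /cs_norm cs_valZ normrZ. Qed.

Lemma cs_normr0_eq0 x : cs_norm x = 0 -> x = 0.
Proof. by move/normr0_eq0 => x0; apply: val_inj; rewrite cs_val0. Qed.

HB.instance Definition _ :=
  Lmodule_isNormed.Build R cs_type cs_ler_normD cs_normrZ cs_normr0_eq0.

Lemma cs_normE x : `|x| = `|val x|. Proof. by []. Qed.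

Lemma cs_lattice_norm x y : vabs x <=v vabs y -> `|x| <= `|y|.
Proof.
rewrite /vle /= /cs_le !cs_val_join !raddfN => xy; rewrite !cs_normE.
exact: lattice_norm.
Qed.

Lemma cs_submul_norm x y : `|x ** y| <= `|x| * `|y|.
Proof. by rewrite !cs_normE cs_val_mul; exact: submul_norm. Qed.

HB.instance Definition _ :=
  isNormedFAlgebra.Build R cs_type cs_lattice_norm cs_submul_norm.

Lemma cs_complete (F : set_system cs_type) :
  ProperFilter F -> cauchy F -> cvg F.
Proof.
move=> FF Fc.
have : cvg (val @ F : set_system A).
  apply: cauchy_cvg; apply/cauchy_ballP => e e0.
  move/cauchy_ballP : Fc => /(_ _ e0) [[P Q]] /= [FP FQ] PQ.
  exists (val @` P, val @` Q) => /=.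
    by split; [apply: filterS FP|apply: filterS FQ] => x Px; exists x.
  move=> [_ _] /= [[x Px <-] [y Qy <-]]; have := PQ (x, y) (conj Px Qy).
  by rewrite -!ball_normE /= cs_normE cs_valB.
move=> /cvg_ex[l Fl].
have Cl : cs_set C l.
  apply: (closed_cvg (cs_set C) (@cs_closed C)) Fl.
  by apply: nearW => x; exact: cs_valP.
apply/cvg_ex; exists (cs_mk Cl); apply/cvgrPdist_lt => e e0.
near=> x; rewrite cs_normE cs_valB cs_mkK; near: x.
exact: cvgr_dist_lt Fl _ e0.
Unshelve. all: by end_near. Qed.

HB.instance Definition _ := Uniform_isComplete.Build cs_type cs_complete.

Definition cs_banach : banachFAlgType R := cs_type.

Section Corestriction.
Context {E : normedModType R} (T : {linear E -> A}).
Hypothesis TC : forall v, cs_set C (T v).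

Definition cs_corestrict (v : E) : cs_type := cs_mk (TC v).

Lemma cs_corestrict_linear : linear cs_corestrict.
Proof.
by move=> t v w; apply: val_inj; rewrite cs_valD cs_valZ !cs_mkK linearP.
Qed.

HB.instance Definition _ :=
  GRing.isLinear.Build R E cs_type *:%R cs_corestrict cs_corestrict_linear.

End Corestriction.

End ClosedSubalgebra.

(** * Free Banach f-algebras *)

Lemma isometry_contractive (R : realType) (V W : normedModType R)
  (T : {linear V -> W}) : (forall x, `|T x| = `|x|) -> contractive T.
Proof.
by move=> iT; apply: ub_ereal_sup => _ [x x1 <-]; rewrite lee_fin iT.
Qed.

Lemma range_fsubalgebra (R : realType) (N A : normedFAlgType R)
  (h : {linear N -> A}) : lattice_algebra_hom h -> fsubalgebra (range h).
Proof.
move=> [hmeet hjoin hmul]; split; first split.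
- by exists 0; rewrite ?linear0.
- by move=> _ _ [x _ <-] [y _ <-]; exists (x + y); rewrite ?linearD.
- by move=> t _ [x _ <-]; exists (t *: x); rewrite ?linearZ.
- by move=> _ _ [x _ <-] [y _ <-]; exists (vmeet x y).
- by move=> _ _ [x _ <-] [y _ <-]; exists (vjoin x y).
- by move=> _ _ [x _ <-] [y _ <-]; exists (x ** y).
Qed.

(** The universal property gives a homomorphism [h] from [B] to the closure of
    [Y]. Followed by the inclusion it extends [eta], as the identity of [B]
    does; by uniqueness [z] is the image of [h z], a point of the closure. *)
Lemma FBfA_dense (R : realType) (E : normedModType R) (B : banachFAlgType R)
  (eta : {linear E -> B}) (Y : set B) :
  is_FBfA eta -> fsubalgebra Y -> (forall x, Y (eta x)) ->
  forall z, closure Y z.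
Proof.
move=> [eta_iso eta_univ] YB Yeta z.
pose C := ClosedSubalgebra (closure_fsubalgebra YB) (@closed_closure _ Y).
have etaC x : cs_set C (eta x) by exact: subset_closure.
have [|h [[hmeet hjoin hmul] h_eta _ _]] :=
  eta_univ (cs_banach C) (cs_corestrict etaC).
  by apply: isometry_contractive => x; rewrite -eta_iso.
have [k [_ _ _ k_uniq]] := eta_univ B eta (isometry_contractive eta_iso).
have vhk : (val \o h) z = k z.
  apply: k_uniq => [|x]; last by rewrite /= h_eta; exact: cs_mkK.
  split=> x y /=; rewrite ?hmeet ?hjoin ?hmul;
    by [exact: cs_val_meet|exact: cs_val_join|exact: cs_val_mul].
have idk : idfun z = k z by exact: k_uniq.
have <- : val (h z) = z by rewrite -[RHS]/(idfun z) idk.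
exact: (cs_valP (C := C)).
Qed.

(* By the universal property of [N] there is at most one [iota] as below: it is
   the inclusion of FNfA[E] in its completion FBfA[E]. *)
Theorem corollary6p6 (R : realType) (E : completeNormedModType R)
  (N : normedFAlgType R) (etaN : {linear E -> N})
  (B : banachFAlgType R) (etaB : {linear E -> B})
  (iota : {linear N -> B}) :
  is_FNfA etaN -> is_FBfA etaB ->
  lattice_algebra_hom iota -> (forall x : E, iota (etaN x) = etaB x) ->
  semiprime B ->
  order_dense (range iota).
Proof.
move=> _ B_free iota_hom iota_eta B_semiprime.
have Y_sub := range_fsubalgebra iota_hom.
apply: dense_fsubalgebra_order_dense => //.
apply: (FBfA_dense B_free) => // x.
by rewrite -iota_eta; exists (etaN x).
Qed.
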